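(* Let $IF_{2m}=\sum_{\iota\in F\mathcal{I}_{2m}(321)} q^{\mathrm{inv}(\iota)}$. Then $IF_0=1$ and for $m>0$, $$IF_{2m}=\sum_{k=1}^m q^{2k-1}\, IF_{2k-2}\, IF_{2(m-k)}.$$
   Context: A permutation $\sigma$ of $[n]$ (one-line notation) contains a pattern $\pi\in\mathfrak{S}_k$ if some subsequence $\sigma(m_1)\cdots\sigma(m_k)$ with $m_1<\dots<m_k$ is in the same relative order as $\pi$; otherwise it avoids $\pi$. An involution is a permutation with $\iota^2=\mathrm{id}$; it is fixed-point-free if $\iota(i)\ne i$ for all $i$. $F\mathcal{I}_n(\pi)$ is the set of fixed-point-free involutions of $[n]$ avoiding $\pi$ ($F\mathcal{I}_0$ contains the empty permutation). $\mathrm{inv}(\sigma)$ is the number of pairs $i<j$ with $\sigma(i)>\sigma(j)$. *)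

(* Defs.v *)
From mathcomp Require Import all_boot all_order all_fingroup all_algebra.

Set Implicit Arguments.
Unset Strict Implicit.
Unset Printing Implicit Defensive.

Import GRing.Theory.

(* Permutations of [n] are elements of 'S_n, with positions and values
   numbered from 0; the empty permutation is the only element of 'S_0. *)

(* [f] lists the positions m_1 < ... < m_k of the occurrence of [p] in [s]. *)
Definition contains (n k : nat) (s : 'S_n) (p : 'S_k) : bool :=
  [exists f : {ffun 'I_k -> 'I_n},
     [forall i : 'I_k, forall j : 'I_k, (i < j) ==> (f i < f j)]
     && [forall i : 'I_k, forall j : 'I_k,
           (s (f i) < s (f j)) == (p i < p j)]].

Definition avoids (n k : nat) (s : 'S_n) (p : 'S_k) : bool :=
  ~~ contains s p.

Definition involution (n : nat) (s : 'S_n) : bool := (s ^+ 2 == 1)%g.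

Definition fixed_point_free (n : nat) (s : 'S_n) : bool :=
  [forall i : 'I_n, s i != i].

Definition FI (n k : nat) (p : 'S_k) : {set 'S_n} :=
  [set s : 'S_n | [&& involution s, fixed_point_free s & avoids s p]].

Definition inv (n : nat) (s : 'S_n) : nat :=
  #|[set ij : 'I_n * 'I_n | (ij.1 < ij.2) && (s ij.2 < s ij.1)]|.

Definition p321 : 'S_3 := perm (@rev_ord_inj 3).

Definition IF (n : nat) : {poly int} :=
  (\sum_(s in FI n p321) 'X ^+ inv s)%R.

(* Main.v *)
Require Import Defs.
From mathcomp Require Import all_boot all_order all_fingroup all_algebra.
From mathcomp Require Import zify.

(** A fixed-point-free involution is a perfect matching, and it avoids 321 iff
    no two arcs are nested, so arcs are closed in the order in which they were
    opened.  Read the points of such a matching from left to right, the first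
    [h] of them all being openers.  Point [h] either opens a further arc, or
    closes the arc of point [0]; the latter arc crosses the [h - 1] other open
    ones, and deleting it removes [2 (h - 1) + 1] inversions.  Hence the
    inversion polynomial counts Dyck paths in which a down step from height [h]
    weighs [q^(2h-1)], and the theorem is their first-return decomposition:
    raising a Dyck path with [k] down steps by one level multiplies its weight
    by [q^(2k)]. *)

Set Implicit Arguments.
Unset Strict Implicit.
Unset Printing Implicit Defensive.

Import GRing.Theory.

Local Open Scope nat_scope.

Lemma sum_ltn_ord n m : m <= n -> \sum_(k < n) (k < m) = m.
Proof.
move=> mn; rewrite -[RHS]card_ord -sum1_card (big_ord_widen n (fun=> 1) mn).
by rewrite [RHS]big_mkcond; apply: eq_bigr => k _; case: ifP.
Qed.

Lemma big_ord_even (T : Type) (idx : T) (op : Monoid.law idx) m (F : nat -> T) :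
  (forall j, odd j -> F j = idx) ->
  \big[op/idx]_(j < m.*2.+1) F j = \big[op/idx]_(k < m.+1) F k.*2.
Proof.
move=> F_odd; elim: m => [|m IH]; first by rewrite !big_ord1.
rewrite doubleS 2!big_ord_recr /= IH [RHS]big_ord_recr doubleS.
by rewrite F_odd ?Monoid.mulm1 //= odd_double.
Qed.

(** * Inserting a point in a permutation *)

Lemma ltn_lift2 n (h : 'I_n) k l : (lift h k < lift h l) = (k < l).
Proof. by rewrite !ltnNge leq_bump2. Qed.

Lemma lift_ltn n (h : 'I_n.+1) (k : 'I_n) : (lift h k < h) = (k < h).
Proof. by rewrite /= /bump; case: leqP; lia. Qed.

Lemma ltn_lift n (h : 'I_n.+1) (k : 'I_n) : (h < lift h k) = (h <= k).
Proof. by rewrite ltn_neqAle neq_lift [LHS]leqNgt lift_ltn -leqNgt. Qed.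

Lemma lift_perm_inj n (i j : 'I_n.+1) : injective (lift_perm i j).
Proof.
move=> t u tu; apply/permP => k; apply: (@lift_inj _ j).
by rewrite -!(lift_perm_lift i) tu.
Qed.

Lemma lift_perm_surj n (i j : 'I_n.+1) (s : 'S_n.+1) :
  s i = j -> exists t, s = lift_perm i j t.
Proof.
move=> sij; pose f k := odflt k (unlift j (s (lift i k))).
have fE k : lift j (f k) = s (lift i k).
  rewrite /f; case: unliftP => //; rewrite -sij => /perm_inj/eqP.
  by rewrite eq_sym (negbTE (neq_lift i k)).
have f_inj : injective f.
  by move=> k l /(congr1 (lift j)); rewrite !fE => /perm_inj/lift_inj.
exists (perm f_inj); apply/permP => x.
case: (unliftP i x) => [k|] ->; last by rewrite lift_perm_id.
by rewrite lift_perm_lift permE.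
Qed.

Lemma invE n (s : 'S_n) :
  Defs.inv s = \sum_(i < n) \sum_(j < n) ((i < j) && (s j < s i)).
Proof.
rewrite /Defs.inv -sum1dep_card pair_bigA /= big_mkcond /=.
by apply: eq_bigr => -[i j] _ /=; case: ifP.
Qed.

Lemma inv_lift_perm n (i j : 'I_n.+1) (t : 'S_n) :
  Defs.inv (lift_perm i j t) =
    Defs.inv t + \sum_(k < n) ((k < i) (+) (t k < j)).
Proof.
set s := lift_perm i j t.
have row_i : \sum_(y < n.+1) ((i < y) && (s y < s i))
             = \sum_(k < n) ((i <= k) && (t k < j)).
  rewrite (bigD1_ord i) //= ltnn add0n; apply: eq_bigr => k _.
  by rewrite ltn_lift /s lift_perm_id lift_perm_lift lift_ltn.
have row_lift k : \sum_(y < n.+1) ((lift i k < y) && (s y < s (lift i k)))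
    = ((k < i) && (j <= t k)) + \sum_(l < n) ((k < l) && (t l < t k)).
  rewrite (bigD1_ord i) //; congr (_ + _).
    by rewrite lift_ltn /s lift_perm_id lift_perm_lift ltn_lift.
  by apply: eq_bigr => l _; rewrite ltn_lift2 /s !lift_perm_lift ltn_lift2.
rewrite !invE (bigD1_ord i) // row_i (eq_bigr _ (fun k _ => row_lift k)).
rewrite big_split /= addnA -big_split addnC; congr (_ + _).
by apply: eq_bigr => k _; case: (ltnP k i); case: (ltnP (t k) j).
Qed.

Lemma inv_lift_perm0l n (j : 'I_n.+1) (t : 'S_n) :
  Defs.inv (lift_perm ord0 j t) = Defs.inv t + j.
Proof.
have jn : j <= n by rewrite -ltnS.
by rewrite inv_lift_perm -[in RHS](sum_ltn_ord jn) [in RHS](reindex_perm t).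
Qed.

Lemma inv_lift_perm0r n (i : 'I_n.+1) (t : 'S_n) :
  Defs.inv (lift_perm i ord0 t) = Defs.inv t + i.
Proof.
rewrite inv_lift_perm; under eq_bigr do rewrite addbF.
by rewrite sum_ltn_ord // -ltnS.
Qed.

(** * Non-nesting matchings *)

Definition nonnesting n (s : 'S_n) : Prop :=
  forall i j : 'I_n, i < j -> j < s j -> s i < s j.

Lemma contains321P n (s : 'S_n) :
  reflect (exists i j k : 'I_n, [/\ i < j, j < k, s k < s j & s j < s i])
          (contains s p321).
Proof.
apply: (iffP existsP) => [[f /andP[/forallP f_mono /forallP s_pat]]|].
  have mono (a b : 'I_3) : a < b -> f a < f b.
    by move=> ab; move/forallP/(_ b)/implyP: (f_mono a); apply.
  have pat (a b : 'I_3) : b < a -> s (f a) < s (f b).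
    move=> ba; move/forallP/(_ b)/eqP: (s_pat a) => ->.
    rewrite !permE /=; have := ltn_ord a; lia.
  exists (f 0%R), (f 1%R), (f 2%R).
  by split; [apply: mono | apply: mono | apply: pat | apply: pat].
move=> [i [j [k [ij jk skj sji]]]].
exists [ffun a : 'I_3 => tnth [tuple i; j; k] a].
by apply/andP; split; apply/forallP => -[[|[|[|a]]] a_lt] //;
   apply/forallP => -[[|[|[|b]]] b_lt] //;
   rewrite !ffunE !(tnth_nth i) ?permE /=; lia.
Qed.

(* If the arc of [j] is nested in that of [i], then [i < j < s j] are the
   positions of an occurrence of 321.  In an occurrence at [i < j < k], the
   arc of [j] is nested in that of [i] if [j] is an opener, and in that of
   [s k] if [j] is a closer. *)
Lemma avoids321P n (s : 'S_n) : involutive s -> (forall i, s i != i) ->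
  reflect (nonnesting s) (avoids s p321).
Proof.
move=> sK fpf; apply: (iffP idP) => [av i j ij jsj | nn].
  rewrite ltnNge; apply: contra av => sji.
  apply/contains321P; exists i, j, (s j); rewrite sK; split=> //.
  rewrite ltn_neqAle sji andbT; apply: contraTneq ij.
  by move=> /val_inj/perm_inj ->; rewrite ltnn.
apply/contains321P => -[i [j [k [ij jk skj sji]]]].
have [j_opens | s_j_le] := ltnP j (s j).
  by have := nn _ _ ij j_opens; lia.
have s_j_lt : s j < j by rewrite ltn_neqAle s_j_le andbT; apply: fpf.
by have := nn _ _ skj; rewrite !sK => /(_ s_j_lt); lia.
Qed.

Lemma involutionP n (s : 'S_n) : reflect (involutive s) (involution s).
Proof.
apply: (iffP eqP) => [s2 x | sK].
  by rewrite -permM -[(s * s)%g]/(s ^+ 2)%g s2 perm1.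
by apply/permP => x; rewrite expgS expg1 permM sK perm1.
Qed.

Lemma FI321P n (s : 'S_n) :
  reflect [/\ involutive s, forall i, s i != i & nonnesting s]
          (s \in FI n p321).
Proof.
rewrite inE; apply: (iffP and3P) => [[/involutionP sK /forallP fpf]|[sK fpf]].
  by move=> /(avoids321P sK fpf).
by move=> /(avoids321P sK fpf); split=> //; [apply/involutionP | apply/forallP].
Qed.

(** * Inserting an arc opened by the first point *)

Section InsertArc.
Variables (n : nat) (h : 'I_n.+1).
Implicit Types (k l : 'I_n) (t : 'S_n).

Definition closer : 'I_n.+2 := lift ord0 h.
Definition other k : 'I_n.+2 := lift ord0 (lift h k).

Definition insert_arc t : 'S_n.+2 :=
  lift_perm ord0 closer (lift_perm h ord0 t).

Lemma closerE : closer = h.+1 :> nat.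
Proof. exact: lift0. Qed.

Lemma insert_arc_ind (P : 'I_n.+2 -> Prop) :
  P ord0 -> P closer -> (forall k, P (other k)) -> forall x, P x.
Proof.
move=> P0 Pc Po x; case: (unliftP ord0 x) => [y|] -> //.
by case: (unliftP h y) => [k|] ->; [apply: Po | apply: Pc].
Qed.

Lemma other_inj : injective other.
Proof. by move=> k l /lift_inj/lift_inj. Qed.

Lemma ltn_other k l : (other k < other l) = (k < l).
Proof. by rewrite !ltn_lift2. Qed.

Lemma other_lt_closer k : (other k < closer) = (k < h).
Proof. by rewrite ltn_lift2 lift_ltn. Qed.

Lemma closer_lt_other k : (closer < other k) = (h <= k).
Proof. by rewrite ltn_lift2 ltn_lift. Qed.

Lemma closer_le_other k : (closer <= other k) = (h <= k).
Proof. by rewrite leqNgt other_lt_closer -leqNgt. Qed.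

Lemma insert_arc0 t : insert_arc t ord0 = closer.
Proof. exact: lift_perm_id. Qed.

Lemma insert_arc_closer t : insert_arc t closer = ord0.
Proof.
by rewrite /insert_arc lift_perm_lift lift_perm_id; apply: val_inj.
Qed.

Lemma insert_arc_other t k : insert_arc t (other k) = other (t k).
Proof.
rewrite /insert_arc !lift_perm_lift; apply: val_inj.
by rewrite /= /bump; lia.
Qed.

Definition insert_arcE := (insert_arc0, insert_arc_closer, insert_arc_other).

Lemma insert_arc_inj : injective insert_arc.
Proof. by move=> t u /lift_perm_inj/lift_perm_inj. Qed.

Lemma insert_arc_surj (s : 'S_n.+2) :
  s ord0 = closer -> s closer = ord0 -> exists t, s = insert_arc t.
Proof.
move=> /lift_perm_surj[u ->]; rewrite lift_perm_lift => u_h.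
have /lift_perm_surj[t ->] : u h = ord0.
  by apply: (@lift_inj _ closer); rewrite u_h; apply: val_inj.
by exists t.
Qed.

Lemma inv_insert_arc t : Defs.inv (insert_arc t) = Defs.inv t + (2 * h + 1).
Proof. by rewrite inv_lift_perm0l inv_lift_perm0r closerE; lia. Qed.

Lemma insert_arc_involutive t : involutive (insert_arc t) <-> involutive t.
Proof.
split=> [tK k | tK]; first by apply: other_inj; rewrite -!insert_arc_other.
by apply: insert_arc_ind => [||k]; rewrite !insert_arcE ?tK.
Qed.

Lemma insert_arc_fixed_point_free t :
  (forall x, insert_arc t x != x) <-> (forall k, t k != k).
Proof.
split=> [fpf k | fpf].
  by have := fpf (other k); rewrite insert_arcE (inj_eq other_inj).
by apply: insert_arc_ind => [||k]; rewrite insert_arcE ?(inj_eq other_inj).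
Qed.

End InsertArc.

(** * Matchings whose first points are openers *)

Definition opens n h (s : 'S_n) : bool :=
  [forall i : 'I_n, (i < h) ==> (h <= s i)].

Lemma opensP n h (s : 'S_n) :
  reflect (forall i : 'I_n, i < h -> h <= s i) (opens h s).
Proof. by apply: (iffP forallP) => op i; apply/implyP/op. Qed.

Lemma opens0 n (s : 'S_n) : opens 0 s.
Proof. exact/opensP. Qed.

Lemma opens_all n (s : 'S_n.+1) : ~~ opens n.+1 s.
Proof. by apply/opensP => /(_ ord0 isT); rewrite leqNgt ltn_ord. Qed.

Lemma opensS n (c : 'I_n) (s : 'S_n) : involutive s ->
  opens c.+1 s = opens c s && (c < s c).
Proof.
move=> sK; apply/opensP/andP => [op | [/opensP op c_opens] i].
  by split; [apply/opensP => i ic; have := op i; lia | apply: op].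
rewrite ltnS leq_eqVlt => /orP[/eqP/val_inj -> // | ic].
rewrite ltn_neqAle op // andbT; apply: contraTneq c_opens => /val_inj c_si.
by rewrite {2}c_si sK -leqNgt ltnW.
Qed.

Lemma opens_insert_arc n (h : 'I_n.+1) (t : 'S_n) :
  opens h.+1 (insert_arc h t) = opens h t.
Proof.
rewrite -[h.+1](closerE h); apply/opensP/opensP => op => [k kh|].
  by rewrite -(closer_le_other h) -insert_arc_other op // other_lt_closer.
apply: (insert_arc_ind (h := h)) => [||k]; rewrite insert_arcE ?ltnn //.
by rewrite other_lt_closer closer_le_other; apply: op.
Qed.

Lemma nonnesting_insert_arc n (h : 'I_n.+1) (t : 'S_n) : opens h t ->
  nonnesting (insert_arc h t) <-> nonnesting t.
Proof.
move=> /opensP op; split=> nn i j.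
  by have := nn (other h i) (other h j); rewrite !insert_arcE !ltn_other.
move: j i; apply: (insert_arc_ind (h := h)) => [||k] //.
  by rewrite insert_arcE.
apply: (insert_arc_ind (h := h)) => [||i]; rewrite !insert_arcE ?ltn_other //.
- rewrite closer_lt_other => _ k_opens.
  by have [/op // | h_le_k] := ltnP k h; apply: leq_trans (ltnW k_opens).
- exact: nn.
Qed.

Lemma insert_arc_FI321 n (h : 'I_n.+1) (t : 'S_n) : opens h t ->
  (insert_arc h t \in FI n.+2 p321) = (t \in FI n p321).
Proof.
move=> op; apply/FI321P/FI321P => -[sK fpf nn]; split.
- exact/(insert_arc_involutive h).
- exact/(insert_arc_fixed_point_free h).
- exact/(nonnesting_insert_arc op).
- exact/insert_arc_involutive.
- exact/insert_arc_fixed_point_free.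
- exact/nonnesting_insert_arc.
Qed.

Lemma nonnesting_first_closer n (h : 'I_n.+1) (s : 'S_n.+2) :
  involutive s -> nonnesting s -> opens h.+1 s -> s (closer h) < closer h ->
  s ord0 = closer h.
Proof.
move=> sK nn /opensP op c_closes.
have [s_c0 | s_c_gt0] := posnP (s (closer h)).
  by rewrite -[RHS]sK; congr (s _); apply: val_inj.
have := nn ord0 _ s_c_gt0; rewrite sK => /(_ c_closes).
by rewrite closerE ltnNge op.
Qed.

Lemma FI321_insert_arcP n (h : 'I_n.+1) (s : 'S_n.+2) :
  reflect (exists2 t, (t \in FI n p321) && opens h t & s = insert_arc h t)
          [&& s \in FI n.+2 p321, opens h.+1 s & ~~ opens h.+2 s].
Proof.
apply: (iffP and3P) => [[s_FI op] | [t /andP[t_FI op] ->]].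
  have /FI321P[sK fpf nn] := s_FI.
  rewrite (opensS (closer h) sK) op /= -leqNgt => s_c_le.
  have c_closes : s (closer h) < closer h.
    by rewrite ltn_neqAle s_c_le andbT; apply: fpf.
  have s0 := nonnesting_first_closer sK nn op c_closes.
  have [t st] : exists t, s = insert_arc h t.
    by apply: insert_arc_surj => //; rewrite -s0 sK.
  move: op s_FI; rewrite {}st opens_insert_arc => op.
  by rewrite insert_arc_FI321 // => t_FI; exists t => //; rewrite t_FI.
rewrite insert_arc_FI321 // opens_insert_arc op; split=> //.
by apply/opensP => /(_ ord0 isT); rewrite insert_arcE closerE ltnn.
Qed.

Local Open Scope ring_scope.

Definition IF_opens (n h : nat) : {poly int} :=
  \sum_(s in FI n p321 | opens h s) 'X ^+ Defs.inv s.

Lemma IF_0 : IF 0 = 1.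
Proof.
rewrite /IF (big_pred1 1%g) => [|s]; first by rewrite invE big_ord0.
by rewrite (permS0 s) /= eqxx; apply/FI321P; split=> -[].
Qed.

Lemma IF_opens0 n : IF_opens n 0 = IF n.
Proof. by apply: eq_bigl => s; rewrite opens0 andbT. Qed.

Lemma IF_opens1 n : IF_opens n.+1 1 = IF_opens n.+1 0.
Proof.
apply: eq_bigl => s; rewrite opens0; apply: andb_id2l => /FI321P[sK fpf _].
by rewrite (opensS ord0 sK) opens0 lt0n; apply: fpf.
Qed.

Lemma IF_opens_all n : IF_opens n.+1 n.+1 = 0.
Proof. by apply: big_pred0 => s; rewrite (negbTE (opens_all s)) andbF. Qed.

Lemma IF_opensS n (h : 'I_n.+1) :
  IF_opens n.+2 h.+1 = IF_opens n.+2 h.+2 + 'X ^+ (2 * h + 1) * IF_opens n h.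
Proof.
rewrite {1}/IF_opens (bigID (opens h.+2)); congr (_ + _).
  apply: eq_bigl => s /=; rewrite -andbA; apply: andb_id2l => /FI321P[sK _ _].
  by rewrite (opensS (closer h) sK) andbA andbb.
rewrite /IF_opens big_distrr /=.
under [RHS]eq_bigr do rewrite -exprD addnC -inv_insert_arc.
rewrite -[RHS](big_imset (fun s => 'X ^+ Defs.inv s)
                 (in2W (@insert_arc_inj n h))) /=.
apply: eq_bigl => s; rewrite -andbA.
by apply/FI321_insert_arcP/imsetP => -[t t_FI ->]; exists t.
Qed.

(** * Weighted Dyck paths *)

(* The total weight of the paths with [n] up and down steps from height [h]
   to height [0], a down step from height [i + 1] weighing [w i]. *)
Fixpoint dyck (R : pzSemiRingType) (w : nat -> R) (n h : nat) : R :=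
  match n, h with
  | 0, 0 => 1
  | 0, _.+1 => 0
  | n.+1, 0 => dyck w n 1
  | n.+1, h.+1 => dyck w n h.+2 + w h * dyck w n h
  end.

Lemma dyck_odd (R : pzSemiRingType) (w : nat -> R) n h :
  odd (n + h) -> dyck w n h = 0.
Proof.
elim: n h => [|n IH] [|h] //= n_h_odd; first by rewrite IH // addn1 -[n]addn0.
by rewrite !IH ?mulr0 ?addr0 //; move: n_h_odd; rewrite !addnS /= ?negbK.
Qed.

(* The path is cut at its first visit to height [0]; the piece before that,
   last step excluded, never goes below height [1]. *)
Lemma dyck_first_passage (R : pzSemiRingType) (w : nat -> R) n h :
  dyck w n h.+1 =
    \sum_(j < n) dyck (w \o succn) j h * w 0%N * dyck w (n - j.+1) 0.
Proof.
elim: n h => [|n IH] h; first by rewrite big_ord0.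
rewrite big_ord_recl subn1 [LHS]/= IH; case: h => [|h].
  by rewrite mul1r addrC.
rewrite /= !mul0r add0r IH big_distrr -big_split /=.
by apply: eq_bigr => j _; rewrite !mulrDl !mulrA.
Qed.

(* A path with [n] steps from height [h] to [0] has [(n + h) / 2] down steps. *)
Lemma dyck_scale (R : comPzSemiRingType) (c : R) (v w : nat -> R) n h :
  (forall i, v i = c * w i) -> dyck v n h = c ^+ (n + h)./2 * dyck w n h.
Proof.
move=> vE; elim: n h => [|n IH] [|h] /=; rewrite ?mulr0 ?mul1r //.
  by rewrite IH addn1 addn0.
by rewrite !IH vE !addnS mulrDr exprS mulrACA.
Qed.

Definition arc_weight (h : nat) : {poly int} := 'X ^+ (2 * h + 1).

Lemma IF_opens_dyck n h : IF_opens (n + h) h = dyck arc_weight n h.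
Proof.
elim: n h => [|n IH] [|h] /=.
- by rewrite IF_opens0 IF_0.
- exact: IF_opens_all.
- by rewrite addn0 -IF_opens1 -IH addn1.
- have h_lt : (h < (n + h).+1)%N by rewrite ltnS leq_addl.
  by rewrite -!IH !addnS addSn (IF_opensS (Ordinal h_lt)).
Qed.

Lemma IF_dyck n : IF n = dyck arc_weight n 0.
Proof. by rewrite -IF_opens_dyck addn0 IF_opens0. Qed.

Lemma IF_odd n : odd n -> IF n = 0.
Proof. by move=> n_odd; rewrite IF_dyck dyck_odd ?addn0. Qed.

Lemma dyck_arc_weightS n :
  dyck (arc_weight \o succn) n 0 = 'X ^+ (2 * n./2) * IF n.
Proof.
rewrite exprM IF_dyck -[n in n./2]addn0; apply: dyck_scale => i.
by rewrite /= /arc_weight -exprD; congr ('X ^+ _); lia.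
Qed.

Lemma IF_first_return n :
  IF n.+2 = \sum_(j < n.+1) 'X ^+ (2 * j./2 + 1) * IF j * IF (n - j).
Proof.
rewrite IF_dyck -[LHS]/(dyck _ n.+1 1) dyck_first_passage.
apply: eq_bigr => j _; rewrite dyck_arc_weightS -IF_dyck subSS.
by rewrite exprD -!mulrA (mulrCA (IF j)).
Qed.

Local Close Scope ring_scope.

Theorem theorem3p14 :
  (IF 0 = 1)%R /\
  (forall m : nat, 0 < m ->
    IF (2 * m) =
      (\sum_(1 <= k < m.+1)
         'X ^+ (2 * k - 1) * IF (2 * k - 2) * IF (2 * (m - k)))%R).
Proof.
split; first exact: IF_0.
case=> // m _; rewrite mul2n doubleS IF_first_return.
pose F j := ('X ^+ (2 * j./2 + 1) * IF j * IF (m.*2 - j))%R.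
rewrite (@big_ord_even _ _ _ m F) => [|j j_odd]; last first.
  by rewrite /F IF_odd // mulr0 mul0r.
rewrite big_add1 /= big_mkord; apply: eq_bigr => k _; rewrite /F.
by congr ('X ^+ _ * IF _ * IF _)%R; lia.
Qed.
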